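(* Let $\sigma=\{\sigma_i \mid i\in I\}$ be a partition of the set of all primes and let $G$ be a finite $\sigma$-full group. Then every complete Hall $\sigma$-set of $G$ forms a $\sigma$-basis of $G$ if and only if $G$ is generalized $\sigma$-soluble and, for every chief factor $H/K$ of $G$, the automorphism group $G/C_{G}(H/K)$ induced by $G$ on $H/K$ satisfies $|\sigma(G/C_{G}(H/K))|\leq 2$ and, moreover, $\sigma(H/K)\subseteq\sigma(G/C_{G}(H/K))$ in the case when $|\sigma(G/C_{G}(H/K))|=2$.
   Context: All groups are finite. $\sigma=\{\sigma_i\mid i\in I\}$ is a partition of the set of all primes. For a positive integer $n$, $\pi(n)$ is the set of primes dividing $n$ and $\sigma(n)=\{\sigma_i \mid \sigma_i\cap\pi(n)\neq\emptyset\}$; for a group $G$, $\sigma(G)=\sigma(|G|)$. A set $\mathcal{H}$ of subgroups of $G$ is a complete Hall $\sigma$-set of $G$ if every member $\neq 1$ of $\mathcal{H}$ is a Hall $\sigma_i$-subgroup of $G$ for some $\sigma_i\in\sigma$, and $\mathcal{H}$ contains exactly one Hall $\sigma_i$-subgroup of $G$ for every $\sigma_i\in\sigma(G)$. $G$ is $\sigma$-full if it possesses a complete Hall $\sigma$-set. A complete Hall $\sigma$-set $\mathcal{H}$ of $G$ is a $\sigma$-basis of $G$ if $AB=BA$ for all $A,B\in\mathcal{H}$. $G$ is generalized $\sigma$-soluble if $G$ is $\sigma$-full and $|\sigma(H/K)|\leq 2$ for every chief factor $H/K$ of $G$. For a chief factor $H/K$, $C_G(H/K)$ is the kernel of the conjugation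 action of $G$ on $H/K$. *)

(* Defs.v *)
(* MathComp, with the sets and cardinals of mathcomp-classical. *)
From mathcomp Require Export all_boot all_fingroup all_solvable.
From mathcomp Require Export boolp classical_sets functions cardinality.

Set Implicit Arguments.
Unset Strict Implicit.
Unset Printing Implicit Defensive.

Local Open Scope classical_set_scope.
Local Open Scope card_scope.
Local Open Scope group_scope.

Definition prime_partition (I : Type) (sigma : I -> nat_pred) : Prop :=
  classical_sets.partition [set: I] (fun i => [set` sigma i]) [set p | prime p].

(* As the blocks of a partition are nonempty and pairwise disjoint, sigma is
   then injective, so that the intensional equality of nat_pred does not
   distort the cardinality of this set of blocks. *)
Definition sigma_of (I : Type) (sigma : I -> nat_pred) (n : nat) :
    set nat_pred :=
  [set sigma i | i in [set i | [set` sigma i] `&` [set` \pi(n)] !=set0]].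

(* HH may contain the trivial group, which is not required to be a Hall
   subgroup for some block. *)
Definition complete_Hall_sigma_set (I : Type) (sigma : I -> nat_pred)
    (gT : finGroupType) (G : {group gT}) (HH : {set {group gT}}) : Prop :=
  [/\ forall H : {group gT}, H \in HH -> H \subset G,
      forall H : {group gT}, H \in HH -> H :!=: 1 ->
        exists i, (sigma i).-Hall(G) H
    & forall i, sigma_of sigma #|G| (sigma i) ->
        exists! H : {group gT}, H \in HH /\ (sigma i).-Hall(G) H].

Definition sigma_full (I : Type) (sigma : I -> nat_pred)
    (gT : finGroupType) (G : {group gT}) : Prop :=
  exists HH : {set {group gT}}, complete_Hall_sigma_set sigma G HH.

Definition sigma_basis (I : Type) (sigma : I -> nat_pred)
    (gT : finGroupType) (G : {group gT}) (HH : {set {group gT}}) : Prop :=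
  complete_Hall_sigma_set sigma G HH /\
  forall A B : {group gT}, A \in HH -> B \in HH -> A * B = B * A.

(* chief_factor G K H says that H / K is a chief factor of G. *)
Definition generalized_sigma_soluble (I : Type) (sigma : I -> nat_pred)
    (gT : finGroupType) (G : {group gT}) : Prop :=
  sigma_full sigma G /\
  forall H K : {group gT}, chief_factor G K H ->
    sigma_of sigma #|H / K| #<= `I_2.

(* 'Q is the conjugation action on cosets, so 'C_G(H / K | 'Q) is the kernel of
   the action of G on H / K. *)
Definition induced_aut_order (gT : finGroupType) (G H K : {group gT}) : nat :=
  #|G / 'C_G(H / K | 'Q)|.

(* Main.v *)
Require Import Defs.

(* Write C for the centraliser in G of a chief factor H/K.  The conditions on the
   right-hand side amount to a single one: if distinct blocks s, t belong to
   sigma(G/C), then H/K is an (s U t)-group.  Three blocks in sigma(G/C) would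
   make H/K trivial, and sigma(H/K) is contained in sigma(G/C) unless H/K is an
   elementary abelian p-group, so this bounds sigma(H/K) as well.

   Two members of a complete Hall set can be replaced by any Hall subgroups for
   the same blocks.  Thus, if all complete Hall sets are bases, a Hall
   s-subgroup A permutes with all conjugates of a Hall t-subgroup B.  When
   neither centralises N = H/K, Kegel's argument gives an (s U t)-subgroup
   X >= A normalised by the normal closure of B, which contains N.  Then X
   meets N in a normal (s U t)-subgroup of N, which cannot be trivial as X does
   not centralise N; so N is an (s U t)-group.

   Conversely, put r = s U t; one shows that (A <*> B)K/K is an r-group for all
   K in a chief series, descending from K = G to K = 1.  Modulo the lower term,
   let N be the chief factor at hand and L = (A <*> B)N, so that L/N is an
   r-group.  If N is not an r-group, then one of A and B, say B, centralises N;
   as 'C_L(N) is an extension of the central r'-group 'Z(N) by an r-group, the subgroup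
   B lies in the normal r-subgroup T = 'O_r('C_L(N)) of L, and the r-group TA
   contains A and B.  Finally an r-group A <*> B has order |A| |B|. *)

Local Open Scope classical_set_scope.
Local Open Scope card_scope.
Local Open Scope group_scope.

(** * Permuting subgroups and minimal normal subgroups *)

Section Groups.

Set Implicit Arguments.
Unset Strict Implicit.

Import mathcomp.boot.fintype mathcomp.boot.finset.

Variable gT : finGroupType.
Implicit Types (pi rho tau : nat_pred) (G L N M A B X Y : {group gT}).

(** With [J = X <*> Y], the set [J * B] is stable under right multiplication by [X] and by [Y],
    hence by [J]. So it contains [B * J], its set of inverses, which has the same size. *)
Lemma commute_joing X Y B : commute X B -> commute Y B -> commute (X <*> Y) B.
Proof.
move=> cXB cYB; set J := X <*> Y.
have stabJB (Z : {group gT}) : Z \subset J -> commute Z B ->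
    Z \subset 'N(J * B | 'R).
  move=> sZJ cZB; apply/subsetP=> z Zz; rewrite !inE.
  apply/subsetP=> _ /mulsgP[j b Jj Bb ->]; rewrite inE /= -mulgA.
  have: b * z \in Z * B by rewrite cZB mem_mulg.
  case/mulsgP=> z' b' Zz' Bb' ->.
  by rewrite mulgA mem_mulg // groupM // (subsetP sZJ).
have nJ: J \subset 'N(J * B | 'R).
  by rewrite join_subG !stabJB ?joing_subl ?joing_subr.
apply/eqP; rewrite eq_sym eqEcard -(card_invg (J * B)) invMg !invGid leqnn andbT.
apply/subsetP=> _ /mulsgP[b j Bb Jj ->].
have /= -> := @astabs_act _ _ _ 'R%act _ j b (subsetP nJ j Jj).
by rewrite -[b]mul1g mem_mulg.
Qed.

Lemma minnormal_sub_or_cent G N M :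
  minnormal N G -> N \subset G -> M <| G -> N \subset M \/ M \subset 'C(N).
Proof.
case/mingroupP=> /andP[ntN nNG] minN sNG /andP[sMG nMG].
have [tiMN | ntMN] := eqVneq (M :&: N) 1; last first.
  by left; apply/setIidPr/(minN (M :&: N)%G); rewrite ?subsetIr // ntMN normsI.
right; apply/commG1P/trivgP; rewrite -tiMN commg_subI // subsetI ?subxx /=.
  exact: subset_trans nNG.
exact: subset_trans nMG.
Qed.

Lemma minnormal_pcore pi G N :
  minnormal N G -> pi.-group N \/ 'O_pi(N) = 1.
Proof.
case/mingroupP=> /andP[ntN nNG] minN.
have [-> | ntO] := eqVneq 'O_pi(N) 1; first by right.
left; rewrite -(minN 'O_pi(N)%G) ?pcore_pgroup ?pcore_sub // ntO.
exact: char_norm_trans (pcore_char pi N) nNG.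
Qed.

(** The centre is characteristic, so if nontrivial it is all of [N], and an abelian minimal normal
    subgroup is elementary abelian. *)
Lemma minnormal_center G N :
  minnormal N G -> 'Z(N) = 1 \/ exists2 p, prime p & p.-group N.
Proof.
move=> minN; have [/andP[ntN nNG] minN'] := mingroupP minN.
have [-> | ntZ] := eqVneq 'Z(N) 1; [by left | right].
have ZN: 'Z(N) = N.
  apply: (minN' 'Z(N)%G); last exact: center_sub.
  by rewrite ntZ; apply: char_norm_trans (center_char N) nNG.
have solN : solvable N by rewrite abelian_sol // -ZN center_abelian.
have [_ _ /is_abelemP[p pr_p /abelem_pgroup pN]] :=
  minnormal_solvable minN (subxx N) solN.
by exists p.
Qed.

Lemma minnormal_pgroup_commute pi G N A B :
    minnormal N G -> N \subset G -> A \subset G -> B \subset G ->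
    pi.-group A -> pi.-group B ->
    (forall g, g \in G -> commute A (B :^ g)) ->
    ~~ (A \subset 'C(N)) -> ~~ (B \subset 'C(N)) ->
  pi.-group N.
Proof.
move=> minN sNG sAG sBG piA piB cAB ncAN ncBN.
have [/andP[ntN nNG] _] := mingroupP minN.
(* Kegel's argument: a maximal pi-subgroup X containing A and permuting with all
   conjugates of B is normalised by them, since X and X :^ b, for b in B :^ g,
   generate a subgroup of X * B :^ g with the same properties.  Hence N, which
   lies in the normal closure of B, normalises X. *)
pose perm X := [&& X \subset G, pi.-group X
  & [forall g in G, (X * B :^ g)%g == B :^ g * X]].
have [|X /maxgroupP[/and3P[sXG piX /forall_inP cXB] maxX] sAX] :=
    @maxgroup_exists _ perm A.
  by rewrite /perm sAG piA; apply/forall_inP=> g Gg; apply/eqP/cAB.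
have {}cXB g : g \in G -> commute X (B :^ g) by move/cXB/eqP.
have nXB g : g \in G -> B :^ g \subset 'N(X).
  move=> Gg; apply/subsetP=> b Bb.
  have Gb: b \in G by rewrite (subsetP _ b Bb) // -(conjGid Gg) conjSg.
  suffices defX: X <*> X :^ b = X by rewrite inE -{2}defX joing_subr.
  apply: (maxX (X <*> X :^ b)%G); last exact: joing_subl.
  apply/and3P; split; first by rewrite join_subG sXG conj_subG.
    have: pi.-group (X <*> B :^ g).
      by rewrite comm_joingE ?pgroupM ?piX ?pgroupJ //; apply: cXB.
    apply: pgroupS; rewrite join_subG joing_subl conj_subG ?joing_subl //.
    exact: subsetP (joing_subr _ _) b Bb.
  apply/forall_inP=> h Gh; apply/eqP/commute_joing; first exact: cXB.
  (* Conjugating the relation for [X] and [B :^ (h * b^-1)] by [b] gives the one for [X :^ b] and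
     [B :^ h]. *)
  have Ghb : h * b^-1 \in G by rewrite groupM ?groupV.
  have := congr1 (fun S => S :^ b) (cXB _ Ghb).
  by rewrite /= !conjsMg -!conjsgM mulgKV.
pose BG := <<class_support B G>>%G.
have nsBG: BG <| G.
  by rewrite /normal gen_subG class_support_subG // norms_gen ?class_support_norm.
have sBBG: B \subset BG by rewrite sub_gen // sub_class_support.
have sNBG: N \subset BG.
  case: (minnormal_sub_or_cent minN sNG nsBG) => // cBG.
  by rewrite (subset_trans sBBG cBG) in ncBN.
have nXN: N \subset 'N(X).
  apply: subset_trans sNBG _; rewrite gen_subG class_supportEr.
  by apply/bigcupsP=> g Gg; apply: nXB.
case: (minnormal_pcore pi minN) => // O1.
have tiXN: X :&: N = 1.
  apply/trivgP; rewrite -O1 pcore_max ?(pgroupS (subsetIl X N)) //.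
  by rewrite /normal subsetIr normsI ?normG.
case/negP: ncAN; apply: subset_trans sAX _.
apply/commG1P/trivgP; rewrite -tiXN commg_subI // subsetI subxx //=.
exact: subset_trans nNG.
Qed.

Lemma join_pgroup_descent tau G N A B :
    minnormal N G -> N \subset G -> A \subset G -> B \subset G ->
    tau.-group A -> tau.-group B -> tau.-group ((A <*> B) / N) ->
    [\/ tau.-group N, A \subset 'C(N) | B \subset 'C(N)] ->
  tau.-group (A <*> B).
Proof.
move=> minN sNG.
have [/andP[_ nNG] _] := mingroupP minN.
have [tauN | ntauN] := boolP (tau.-group N).
  move=> sAG sBG _ _ tauAB _; have nNAB: A <*> B \subset 'N(N).
    by rewrite join_subG !(subset_trans _ nNG).
  by rewrite -(pquotient_pgroup tauN nNAB).
(* If [N] is a [p]-group, then [p] is outside [tau], as otherwise [N] would be a [tau]-group. *)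
have tau'Z: tau^'.-group 'Z(N).
  have [-> | [p _ pN]] := minnormal_center minN; first exact: pgroup1.
  apply: pgroupS (center_sub N) _; apply: (sub_pgroup _ pN) => q /eqnP ->.
  by apply: contra ntauN => tau_p; apply: (sub_pgroup _ pN) => r /eqnP ->.
wlog: A B / B \subset 'C(N).
  move=> IH sAG sBG tauA tauB tauAB [tauN|cAN|cBN]; first by case/negP: ntauN.
    rewrite joingC; apply: IH => //; first by rewrite joingC.
    exact: Or33.
  by apply: IH => //; apply: Or33.
move=> cBN sAG sBG tauA tauB tauAB _.
pose L := (A <*> B <*> N)%G.
have nNAB: A <*> B \subset 'N(N) by rewrite join_subG !(subset_trans _ nNG).
have nNL: L \subset 'N(N) by rewrite join_subG nNAB normG.
have tauLN: tau.-group (L / N) by rewrite quotientYidr.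
have sBL: B \subset L by rewrite (subset_trans (joing_subr A B)) ?joing_subl.
have sAL: A \subset L by rewrite (subset_trans (joing_subl A B)) ?joing_subl.
pose D := 'C_L(N)%G.
have sDL: D \subset L := subsetIl _ _.
have nsDL: D <| L by rewrite /normal sDL normsI ?normG ?norms_cent.
have sZD: 'Z(N) \subset D by rewrite setSI ?joing_subr.
have cZD: D \subset 'C('Z(N)).
  by apply: subset_trans (subsetIr _ _) (centS _); apply: center_sub.
have nsZD: 'Z(N) <| D by rewrite /normal sZD cents_norm.
have DIN: D :&: N = 'Z(N).
  by rewrite /= setIAC (setIidPr (joing_subr _ _)).
(* [D / 'Z(N)] and [D / N] have the same order, the index of [D :&: N] in [D]. *)
have tauDZ: tau.-group (D / 'Z(N)).
  have: tau.-group (D / N) by apply: pgroupS tauLN; apply: quotientS.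
  rewrite /pgroup (card_quotient (subset_trans sDL nNL)) -indexgI DIN.
  by rewrite -card_quotient ?normal_norm.
have hallZ: tau^'.-Hall(D) 'Z(N).
  by rewrite /pHall sZD tau'Z pnatNK -card_quotient ?normal_norm.
(* T is the tau-part of D = 'Z(N) x T, hence normal in L, and contains B. *)
have /splitsP[T complT] := SchurZassenhaus_split (pHall_Hall hallZ) nsZD.
have hallT: tau.-Hall(D) T by rewrite -(compl_p'Hall _ hallZ).
have [tiZT defD] := complP complT.
have nsTD: T <| D.
  rewrite /normal (pHall_sub hallT) -{1}defD mul_subG ?normG //.
  rewrite cents_norm // centsC; apply: subset_trans cZD.
  exact: pHall_sub hallT.
have sBT: B \subset T.
  by rewrite (sub_normal_Hall hallT nsTD) // subsetI sBL.
have TO: T :=: 'O_tau(D) by rewrite (normal_Hall_pcore hallT).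
have nTA: A \subset 'N(T).
  rewrite TO; apply: char_norm_trans (pcore_char _ _) _.
  exact: subset_trans sAL (normal_norm nsDL).
have: tau.-group (A <*> T).
  by rewrite norm_joinEl // pgroupM tauA (pHall_pgroup hallT).
by apply: pgroupS; rewrite genS // setUS.
Qed.

(** The primes of [J = A <*> B] outside [pi] lie in [rho], so the order of [B] is the [pi^']-part of
    [#|J|]. Comparing orders, [A * B] is all of [J], and factors whose product is a group
    commute. *)
Lemma Hall_commute pi rho G A B :
    pi.-Hall(G) A -> rho.-Hall(G) B -> {in rho, forall p, p \notin pi} ->
    [predU pi & rho].-group (A <*> B) -> commute A B.
Proof.
move=> hA hB dis tauJ; set J := (A <*> B)%G.
have sJG : J \subset G by rewrite join_subG !(pHall_sub hA, pHall_sub hB).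
have hAJ := pHall_subl (joing_subl A B) sJG hA.
have hBJ := pHall_subl (joing_subr A B) sJG hB.
have oB: #|B| = (#|J| `_pi^')%N.
  rewrite (card_Hall hBJ); apply: eq_in_partn => p piJp.
  have := pnatPpi tauJ piJp; rewrite !inE.
  by case: (boolP (p \in rho)) => [/dis->|_]; rewrite ?orbF // => ->.
have tiAB: A :&: B = 1.
  apply: coprime_TIg; rewrite oB (card_Hall hAJ).
  exact: coprime_partC.
have: (A * B)%g = J.
  apply/eqP; rewrite eqEcard mul_subG ?joing_subl ?joing_subr //=.
  by rewrite TI_cardMg // oB (card_Hall hAJ) partnC.
by move=> defJ; apply/comm_group_setP; rewrite defJ groupP.
Qed.

End Groups.

(** * Sets with two elements, or with at most two *)

Section Cardinals.

Set Implicit Arguments.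
Unset Strict Implicit.

Variable T : Type.
Implicit Types (S : set T) (x y z : T).

Lemma card_set2 x y : x <> y -> [set x; y] #= `I_2.
Proof.
move=> neq_xy; apply/eq_cardSP; exists x; first by left.
suff -> : [set x; y] `\ x = [set y] by exact: card_set1.
apply/seteqP; split=> z /=; first by case=> [[-> | ->]].
by move=> ->; split; [right | move/esym].
Qed.

Lemma card_eq2P S : S #= `I_2 <-> exists x y, x <> y /\ S = [set x; y].
Proof.
split=> [|[x [y [neq_xy ->]]]]; last exact: card_set2.
case/eq_cardSP=> x Sx /eq_cardSP[y [Sy /= neq_yx]]; rewrite II0 card_eq0 => /eqP S0.
exists x, y; split; first exact: nesym.
apply/seteqP; split=> z /=; last by case=> ->.
move=> Sz; apply: contrapT => /not_orP[neq_zx neq_zy].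
suff: (set0 : set T) z by [].
by rewrite -S0.
Qed.

Lemma card_le2P S :
  S #<= `I_2 <-> forall x y z, S x -> S y -> S z -> [\/ x = y, x = z | y = z].
Proof.
split=> [leS2 x y z Sx Sy Sz | S3].
  apply: contrapT => neq.
  have neq_xy : x <> y by move=> E; apply: neq; apply: Or31.
  have neq_xz : x <> z by move=> E; apply: neq; apply: Or32.
  have neq_yz : y <> z by move=> E; apply: neq; apply: Or33.
  suff: `I_3 #<= `I_2 by rewrite card_le_II.
  suff: `I_3 #<= S by move/card_le_trans; apply.
  have /card_eqPle[_ le3]: [set x; y; z] #= `I_3.
    apply/eq_cardSP; exists z; first by right.
    suff -> : [set x; y; z] `\ z = [set x; y] by exact: card_set2.
    apply/seteqP; split=> t /=; first by case=> [[]].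
    by case=> ->; split; [left; left | | left; right | ].
  apply: card_le_trans le3 (subset_card_le _).
  by move=> t /= [[]|] ->.
have [[x Sx] | S0] := pselect (exists x, S x); last first.
  have -> : S = set0 by apply/seteqP; split=> // x Sx; case: S0; exists x.
  exact: card_ge0.
have [[y [Sy neq_xy]] | Sx1] := pselect (exists y, S y /\ x <> y).
  have /card_eqPle[le2 _] := card_set2 neq_xy.
  apply: card_le_trans (subset_card_le _) le2 => z Sz /=.
  by case: (S3 x y z Sx Sy Sz) => [||] E; [case: neq_xy|left|right].
have /card_eqPle[le1 _] := @card_set1 _ x.
apply: (@card_le_trans _ _ _ `I_1); last by rewrite card_le_II.
apply: card_le_trans (subset_card_le _) le1 => z Sz /=.
by apply: contrapT => neq; apply: Sx1; exists z; split=> // /esym.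
Qed.

End Cardinals.

(** * Blocks of the partition and Hall subgroups *)

Section Sigma.

Set Implicit Arguments.
Unset Strict Implicit.

Import mathcomp.boot.fintype mathcomp.boot.finset.

Variables (I : Type) (sigma : I -> nat_pred).
Hypothesis sigma_part : prime_partition sigma.
Variable gT : finGroupType.
Implicit Types (i j : I) (G H K A B C V : {group gT}).

Lemma sigma_block_eq i j p : p \in sigma i -> p \in sigma j -> sigma i = sigma j.
Proof.
move=> pi pj; have [_ trivS _] := sigma_part; congr sigma.
by apply: trivS => //; exists p.
Qed.

Lemma sigma_cover p : prime p -> exists i, p \in sigma i.
Proof.
have [covS _ _] := sigma_part.
by rewrite -[is_true _]/([set p | prime p]%classic p) -covS => -[i _]; exists i.
Qed.

(** Positivity matters: [\pi(0)] is empty, while [pnat] is false at 0. *)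
Lemma sigma_ofE n i : (0 < n)%N ->
  sigma_of sigma n (sigma i) <-> ~~ (sigma i)^'.-nat n.
Proof.
move=> n_gt0; rewrite /pnat n_gt0 /=; split.
  case=> j [p [/= pj pn]] <-; apply/allPn; exists p => //.
  by rewrite /= inE /= negbK.
case/allPn=> p pn; rewrite /= inE /= negbK => pi.
by exists i => //; exists p.
Qed.

Lemma sigma_of_block n S : sigma_of sigma n S -> exists i, S = sigma i.
Proof. by case=> i _ <-; exists i. Qed.

Lemma sigma_of_dvdn m n : (0 < n)%N -> m %| n ->
  (sigma_of sigma m `<=` sigma_of sigma n)%classic.
Proof.
move=> n_gt0 dvd_mn S Sm; have [i defS] := sigma_of_block Sm; move: Sm.
rewrite {}defS !sigma_ofE // ?(dvdn_gt0 n_gt0) //.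
by apply: contra => /pnat_dvd; apply.
Qed.

(** The image of [A] is a Hall [pi]-subgroup of [G / C]. With [C] the kernel on a chief factor, this
    detects the blocks of the induced automorphism group. *)
Lemma sub_normal_Hall_pgroup pi G A C :
  pi.-Hall(G) A -> C <| G -> (A \subset C) = pi^'.-group (G / C).
Proof.
move=> hallA nsCG; have nCA := subset_trans (pHall_sub hallA) (normal_norm nsCG).
have hallAC := quotient_pHall nCA hallA.
have [sAC piAC pi'GA] := and3P hallAC; rewrite -quotient_sub1 //.
apply/idP/idP=> [/trivgP A1 | pi'GC].
  by rewrite A1 indexg1 in pi'GA.
by rewrite subG1 trivg_card1 (pnat_1 piAC (pgroupS sAC pi'GC)).
Qed.

Lemma Hall_sigma_quotient G A C i : (sigma i).-Hall(G) A -> C <| G ->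
  sigma_of sigma #|G / C| (sigma i) <-> ~~ (A \subset C).
Proof.
by move=> hallA nsCG; rewrite sigma_ofE // (sub_normal_Hall_pgroup hallA nsCG).
Qed.

Lemma Hall_sigma_ntriv G A i : (sigma i).-Hall(G) A ->
  sigma_of sigma #|G| (sigma i) <-> A :!=: 1.
Proof.
move=> hallA; rewrite -subG1 -(Hall_sigma_quotient hallA (normal1 G)).
by rewrite -(card_isog (quotient1_isog G)).
Qed.

Lemma pgroup_block_eq A i j : A :!=: 1 ->
  (sigma i).-group A -> (sigma j).-group A -> sigma i = sigma j.
Proof.
rewrite -cardG_gt1 -pi_pdiv => pA piA pjA.
exact: sigma_block_eq (pnatPpi piA pA) (pnatPpi pjA pA).
Qed.

(** Through this, a hypothesis on all complete Hall sets applies to any two nontrivial Hall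
    subgroups for distinct blocks. *)
Lemma complete_Hall_sigma_set_pair G A B i j (HH : {set {group gT}}) :
    complete_Hall_sigma_set sigma G HH -> sigma i <> sigma j ->
    A :!=: 1 -> (sigma i).-Hall(G) A -> B :!=: 1 -> (sigma j).-Hall(G) B ->
  exists HH' : {set {group gT}},
    [/\ complete_Hall_sigma_set sigma G HH', A \in HH' & B \in HH'].
Proof.
move=> [sHG hallH uniqH] neq_ij ntA hallA ntB hallB.
(* Members of [HH] that are Hall for one of the two blocks make way for [A] and [B], which keeps
   uniqueness. *)
pose other H := ~~ (sigma i).-Hall(G) H && ~~ (sigma j).-Hall(G) H.
pose HH' := finset (fun H => [|| H == A, H == B | (H \in HH) && other H]).
exists HH'; split; [| by rewrite !inE eqxx | by rewrite !inE eqxx orbT].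
split=> [H | H | k Gk].
- by rewrite !inE => /or3P[/eqP-> | /eqP-> | /andP[/sHG //]];
    [exact: pHall_sub hallA | exact: pHall_sub hallB].
- rewrite !inE => /or3P[/eqP-> | /eqP-> | /andP[/hallH //]] _; by [exists i|exists j].
have nt H : (sigma k).-Hall(G) H -> H :!=: 1 by move/Hall_sigma_ntriv => <-.
have block H l : (sigma k).-Hall(G) H -> (sigma l).-Hall(G) H ->
    sigma k = sigma l.
  move=> hallk halll.
  exact: pgroup_block_eq (nt _ hallk) (pHall_pgroup hallk) (pHall_pgroup halll).
have [ki | neq_ki] := pselect (sigma k = sigma i).
  exists A; split=> [|H [+ hallkH]]; first by rewrite !inE eqxx ki.
  rewrite !inE => /or3P[/eqP-> // | /eqP HB | /and3P[_ /negP[]]]; last by rewrite -ki.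
  by case: neq_ij; rewrite -ki; apply: (block H) => //; rewrite HB.
have [kj | neq_kj] := pselect (sigma k = sigma j).
  exists B; split=> [|H [+ hallkH]]; first by rewrite !inE eqxx orbT kj.
  rewrite !inE => /or3P[/eqP HA | /eqP-> // | /and3P[_ _ /negP[]]]; last by rewrite -kj.
  by case: neq_ij; rewrite -kj; apply/esym/(block H) => //; rewrite HA.
have [H [[HHH hallkH] uniq]] := uniqH k Gk; exists H; split=> [|K [+ hallkK]].
  rewrite !inE HHH hallkH; split=> //; apply/or3P/Or33/andP.
  split=> //; apply/andP.
  split; apply/negP=> hall.
    by case: neq_ki; apply: (block H).
  by case: neq_kj; apply: (block H).
rewrite !inE => /or3P[/eqP KA | /eqP KB | /andP[HHK _]]; last exact: uniq.
  by case: neq_ki; apply: (block K) => //; rewrite KA.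
by case: neq_kj; apply: (block K) => //; rewrite KB.
Qed.

(** * Chief factors and their centralisers *)

Lemma chief_cent_normal G H K :
  K <| G -> H <| G -> 'C_G(H / K | 'Q) <| G.
Proof.
move=> nsKG nsHG; rewrite /normal subsetIl normsI ?normG // astabQ.
apply: subset_trans (morphpre_norm _ _); rewrite -sub_morphim_pre ?(normal_norm nsKG) //.
by rewrite norms_cent // quotient_norms // normal_norm.
Qed.

Lemma sub_chief_cent G H K A : K <| G -> A \subset G ->
  (A \subset 'C_G(H / K | 'Q)) = (A / K \subset 'C(H / K)).
Proof.
move=> nsKG sAG; rewrite subsetI sAG sub_astabQ.
by rewrite (subset_trans sAG (normal_norm nsKG)).
Qed.

Lemma chief_factorP G H K : chief_factor G K H ->
  [/\ K <| G, H <| G, K \proper H & minnormal (H / K) (G / K)].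
Proof.
move=> chHK; have minHK := chief_factor_minnormal chHK.
have /andP[/maxgroupP[/andP[prKH nKG] _] nsHG] := chHK; split=> //.
by rewrite /normal nKG (subset_trans (proper_sub prKH)) ?normal_sub.
Qed.

Definition chief_block_condition G :=
  forall H K : {group gT}, chief_factor G K H -> forall i j,
    sigma i <> sigma j ->
    sigma_of sigma (induced_aut_order G H K) (sigma i) ->
    sigma_of sigma (induced_aut_order G H K) (sigma j) ->
  [predU sigma i & sigma j].-group (H / K).

Lemma chief_block_of_commute G :
    sigma_full sigma G ->
    (forall A B i j, sigma i <> sigma j -> A :!=: 1 -> (sigma i).-Hall(G) A ->
       B :!=: 1 -> (sigma j).-Hall(G) B -> commute A B) ->
  chief_block_condition G.
Proof.
move=> [HH [_ _ hallHH]] cHall H K chHK i j neq_ij Ci Cj.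
have [nsKG nsHG prKH minHK] := chief_factorP chHK.
have nsCG := chief_cent_normal nsKG nsHG.
have exHall l : sigma_of sigma (induced_aut_order G H K) (sigma l) ->
    exists A, [/\ (sigma l).-Hall(G) A, A :!=: 1 & ~~ (A / K \subset 'C(H / K))].
  move=> Cl; have Gl : sigma_of sigma #|G| (sigma l).
    by apply: sigma_of_dvdn Cl => //; apply: dvdn_quotient.
  have [A [[_ hallA] _]] := hallHH _ Gl; exists A; split=> //.
    by apply/(Hall_sigma_ntriv hallA).
  rewrite -(sub_chief_cent H nsKG) ?(pHall_sub hallA) //.
  exact/(Hall_sigma_quotient hallA nsCG).
have [A [hallA ntA ncA]] := exHall i Ci.
have [B [hallB ntB ncB]] := exHall j Cj.
have [sAG piA _] := and3P hallA; have [sBG piB _] := and3P hallB.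
have nKG := normal_norm nsKG.
apply: (minnormal_pgroup_commute minHK _ (quotientS K sAG) (quotientS K sBG)) ncA ncB.
- exact/quotientS/normal_sub.
- by apply/quotient_pgroup/(sub_pgroup _ piA) => p pi; rewrite inE /= pi.
- by apply/quotient_pgroup/(sub_pgroup _ piB) => p pi; rewrite inE /= pi orbT.
(* Conjugates of [B / K] in [G / K] come from conjugates of [B], which are again Hall subgroups of
   [G]. *)
move=> _ /morphimP[g Ng Gg ->].
have cAB : commute A (B :^ g).
  by apply: (cHall _ (B :^ g)%G i j); rewrite ?pHallJ ?conjsg_eq1.
rewrite -quotientJ // /commute -!quotientMl ?cAB //.
  by rewrite conj_subG // (subset_trans sBG).
exact: subset_trans nKG.
Qed.

Lemma Hall_commute_of_chief_block G A B i j :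
    chief_block_condition G -> sigma i <> sigma j ->
    (sigma i).-Hall(G) A -> (sigma j).-Hall(G) B -> commute A B.
Proof.
move=> cond neq_ij hallA hallB; set tau := [predU sigma i & sigma j].
have [sAG piA _] := and3P hallA; have [sBG piB _] := and3P hallB.
apply: (Hall_commute hallA hallB).
  by move=> p pj; apply/negP=> /sigma_block_eq/(_ pj).
have tauA : tau.-group A by apply: sub_pgroup piA => p pi; rewrite inE /= pi.
have tauB : tau.-group B by apply: sub_pgroup piB => p pj; rewrite inE /= pj orbT.
have sJG : A <*> B \subset G by rewrite join_subG sAG.
have: tau.-group ((A <*> B) / G) by rewrite quotientS1 // pgroup1.
have [n] := ubnP #|G|.
have: G <| G by apply: normal_refl.
(* [K] is the current term of the series, starting at [G]; the ambient group in [G <| G] stays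
   fixed. *)
elim: n {-2}G => // n IH K nsKG /ltnSE le_n tauK.
have [K1 | ntK] := eqVneq (K : {set gT}) 1.
  by move: tauK; rewrite /pgroup K1 -(card_isog (quotient1_isog _)).
have [V maxV _] : {V : {group gT} | maxnormal V K G & 1%G \subset V}.
  by apply: maxgroup_exists; rewrite proper1G ntK norms1.
have chVK : chief_factor G V K by rewrite /chief_factor maxV.
have [nsVG _ prVK minN] := chief_factorP chVK.
have nVG := normal_norm nsVG; have nVJ := subset_trans sJG nVG.
apply: (IH V nsVG); first exact: leq_trans (proper_card prVK) le_n.
have [nVA nVB] := (subset_trans sAG nVG, subset_trans sBG nVG).
rewrite quotientY //.
apply: (join_pgroup_descent minN (quotientS V (normal_sub nsKG)) (quotientS V sAG)
  (quotientS V sBG) (quotient_pgroup V tauA) (quotient_pgroup V tauB)).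
  (* By the third isomorphism theorem, [(J <*> K) / V] modulo [K / V] is [J / K], up to
     isomorphism. *)
  rewrite -quotientY //; set J := A <*> B.
  have nKJ := subset_trans sJG (normal_norm nsKG).
  have nsVL : V <| J <*> K.
    rewrite /normal (subset_trans (proper_sub prVK) (joing_subr _ _)).
    by rewrite join_subG nVJ (subset_trans (normal_sub nsKG) nVG).
  have nsKL : K <| J <*> K by rewrite normalYr.
  have := third_isog (proper_sub prVK) nsVL nsKL.
  move/card_isog; rewrite /= quotientYidr // => oJ.
  have: tau.-group (J <*> K / V / (K / V)) by rewrite /pgroup oJ.
  by apply: pgroupS; rewrite !quotientS ?joing_subl.
have nsCG := chief_cent_normal nsVG nsKG.
have [cA | ncA] := boolP (A / V \subset 'C(K / V)); first exact: Or32.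
have [cB | ncB] := boolP (B / V \subset 'C(K / V)); first exact: Or33.
apply: Or31; apply: cond => //.
  by apply/(Hall_sigma_quotient hallA nsCG); rewrite sub_chief_cent.
by apply/(Hall_sigma_quotient hallB nsCG); rewrite sub_chief_cent.
Qed.

Lemma pnat_sigma_of p n i : prime p -> p.-nat n ->
  sigma_of sigma n (sigma i) -> p \in sigma i.
Proof.
move=> pr_p pn; have [n_gt0 _] := andP pn.
rewrite sigma_ofE //; apply: contraNT => sigma'p.
by apply: (sub_in_pnat _ pn) => q _ /eqnP ->.
Qed.

Lemma chief_block_conditionP G :
  chief_block_condition G <->
  forall H K : {group gT}, chief_factor G K H ->
    (sigma_of sigma (induced_aut_order G H K) #<= `I_2)%card /\
    ((sigma_of sigma (induced_aut_order G H K) #= `I_2)%card ->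
     (sigma_of sigma #|H / K| `<=` sigma_of sigma (induced_aut_order G H K))%classic).
Proof.
split=> cond H K chHK; last first.
  have [le2 sub] := cond H K chHK.
  move=> i j neq_ij Ci Cj; apply/pgroupP=> p pr_p p_dvd.
  have eq2 : (sigma_of sigma (induced_aut_order G H K) #= `I_2)%card.
    rewrite card_eq_le le2 /=.
    have /card_eqPle[_ ge2] := card_set2 neq_ij.
    by apply: card_le_trans ge2 (subset_card_le _) => S [] ->.
  have [k pk] := sigma_cover pr_p.
  have HKk : sigma_of sigma #|H / K| (sigma k).
    by exists k => //; exists p; split=> //=; rewrite mem_primes pr_p cardG_gt0.
  rewrite inE /=.
  case/card_le2P/(_ _ _ _ Ci Cj (sub eq2 _ HKk)): le2 => [// | -> | ->]; rewrite pk //.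
  by rewrite orbT.
have [_ _ _ minHK] := chief_factorP chHK.
have [/andP[ntHK _] _] := mingroupP minHK.
split.
  apply/card_le2P => x y z Cx Cy Cz.
  have [[i defx] [j defy]] := (sigma_of_block Cx, sigma_of_block Cy).
  have [k defz] := sigma_of_block Cz; subst x y z.
  have [eij | neq_ij] := pselect (sigma i = sigma j); first exact: Or31.
  have [eik | neq_ik] := pselect (sigma i = sigma k); first exact: Or32.
  have [ejk | neq_jk] := pselect (sigma j = sigma k); first exact: Or33.
  (* A prime of the nontrivial [H / K] lies in the union of any two of the three blocks, hence in at
     least two of them, which then coincide. *)
  have pHK : pdiv #|H / K| \in \pi(#|H / K|) by rewrite pi_pdiv cardG_gt1.
  have := pnatPpi (cond H K chHK i j neq_ij Cx Cy) pHK.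
  have := pnatPpi (cond H K chHK i k neq_ik Cx Cz) pHK.
  have := pnatPpi (cond H K chHK j k neq_jk Cy Cz) pHK.
  rewrite !inE /= => /orP[] p1 /orP[] p2 /orP[] p3;
    solve [by apply: Or31; apply: sigma_block_eq; eassumption
         | by apply: Or32; apply: sigma_block_eq; eassumption
         | by apply: Or33; apply: sigma_block_eq; eassumption].
case/card_eq2P=> x [y [neq_xy defC]] S HKS.
have Cx : sigma_of sigma (induced_aut_order G H K) x by rewrite defC; left.
have Cy : sigma_of sigma (induced_aut_order G H K) y by rewrite defC; right.
have [[i defx] [j defy]] := (sigma_of_block Cx, sigma_of_block Cy); subst x y.
have [k defS] := sigma_of_block HKS; subst S.
have tauHK := cond H K chHK i j neq_xy Cx Cy.
have [p /= [pk pHK]] : ([set` sigma k] `&` [set` \pi(#|H / K|)] !=set0)%classic.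
  by case: HKS => l [p [pl pHK]] <-; exists p.
have := pnatPpi tauHK pHK; rewrite inE /= => /orP[pi | pj].
  by rewrite (sigma_block_eq pk pi).
by rewrite (sigma_block_eq pk pj).
Qed.

(** For [C] the kernel on [H / K], the image of [H :&: C] in [H / K] is central, so [H :&: C] lies
    in [K]. Hence [#|H / K|] divides the order of [H / C], a subgroup of [G / C]. *)
Lemma chief_nonabelian_dvdn G H K : chief_factor G K H -> 'Z(H / K) = 1 ->
  #|H / K| %| induced_aut_order G H K.
Proof.
move=> chHK Z1; have [nsKG nsHG _ _] := chief_factorP chHK.
have nsCG := chief_cent_normal nsKG nsHG.
rewrite /induced_aut_order; set C := 'C_G(H / K | 'Q)%G.
have sHG := normal_sub nsHG.
have nKH := subset_trans sHG (normal_norm nsKG).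
have sHCK : H :&: C \subset K.
  rewrite -quotient_sub1; last exact: subset_trans (subsetIl _ _) nKH.
  rewrite -Z1 subsetI quotientS ?subsetIl //=.
  rewrite -(sub_chief_cent H nsKG) ?subsetIr //.
  exact: subset_trans (subsetIl _ _) sHG.
apply: dvdn_trans (cardSg (quotientS C sHG)).
rewrite !card_quotient ?(subset_trans sHG (normal_norm nsCG)) //.
by rewrite -(indexgI H C); apply: indexgS.
Qed.

(** If ['Z(H / K)] is trivial, the blocks of [H / K] occur in the induced automorphism group;
    otherwise [H / K] is a [p]-group, with a single block. *)
Lemma card_sigma_of_chief G H K : chief_block_condition G ->
  chief_factor G K H -> (sigma_of sigma #|H / K| #<= `I_2)%card.
Proof.
move=> /chief_block_conditionP cond chHK; have [_ _ _ minHK] := chief_factorP chHK.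
have [Z1 | [p pr_p pHK]] := minnormal_center minHK.
  have [le2 _] := cond H K chHK; apply: card_le_trans (subset_card_le _) le2.
  apply: sigma_of_dvdn (chief_nonabelian_dvdn chHK Z1) => //; exact: cardG_gt0.
apply/card_le2P=> x y z HKx HKy _; apply: Or31.
have [[i defx] [j defy]] := (sigma_of_block HKx, sigma_of_block HKy); subst x y.
exact: sigma_block_eq (pnat_sigma_of pr_p pHK HKx) (pnat_sigma_of pr_p pHK HKy).
Qed.

End Sigma.

Theorem theoremC (I : Type) (sigma : I -> nat_pred)
    (sigma_part : prime_partition sigma)
    (gT : finGroupType) (G : {group gT}) (G_full : sigma_full sigma G) :
  (forall HH : {set {group gT}},
     complete_Hall_sigma_set sigma G HH -> sigma_basis sigma G HH)
  <->
  (generalized_sigma_soluble sigma G /\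
   forall H K : {group gT}, chief_factor G K H ->
     sigma_of sigma (induced_aut_order G H K) #<= `I_2 /\
     (sigma_of sigma (induced_aut_order G H K) #= `I_2 ->
      sigma_of sigma #|H / K| `<=` sigma_of sigma (induced_aut_order G H K))).
Proof.
split=> [basisG | [_ /(chief_block_conditionP sigma_part) cond] HH HHG].
  have cond : chief_block_condition sigma G.
    apply: (chief_block_of_commute G_full).
    move=> A B i j neq_ij ntA hallA ntB hallB; have [HH HHG] := G_full.
    have [HH' [HH'G HHA HHB]] := complete_Hall_sigma_set_pair sigma_part
      HHG neq_ij ntA hallA ntB hallB.
    by have [_] := basisG HH' HH'G; apply.
  split; last exact/(chief_block_conditionP sigma_part).
  by split=> // H K; apply: card_sigma_of_chief.
split=> // A B HHA HHB; have [_ hallHH uniqHH] := HHG.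
have [-> | ntA] := eqVneq (A : {set gT}) 1; first by rewrite mul1g mulg1.
have [-> | ntB] := eqVneq (B : {set gT}) 1; first by rewrite mul1g mulg1.
have [[i hallA] [j hallB]] := (hallHH A HHA ntA, hallHH B HHB ntB).
have [eq_ij | neq_ij] := pselect (sigma i = sigma j); last first.
  exact: (Hall_commute_of_chief_block sigma_part cond neq_ij).
(* Members for the same block coincide by uniqueness. *)
have Gi := (Hall_sigma_ntriv hallA).2 ntA.
have [H [_ uniqH]] := uniqHH i Gi; rewrite -eq_ij in hallB.
by rewrite -(uniqH A) // -(uniqH B).
Qed.
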